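(* Let $\beta>1$ such that the generating sequence $g(\beta)$ is eventually periodic but not periodic, and let $n,p\in\mathbb{N}$ be minimal such that $g(\beta)=g_1\cdots g_n(g_{n+1}\cdots g_{n+p})^\infty$. Then the fiber product cover of the beta-shift $\mathsf{X}_\beta$ is (isomorphic to) the labelled graph with vertices $v_1,\ldots,v_{n+p}$, $v'_{n+1},\ldots,v'_{n+p}$, $v''_{n+1},\ldots,v''_{n+p}$ and exactly the following edges: (1) for $1\le i\le n+p$ and $0\le k<g_i$, an edge labelled $k$ from $v_i$ to $v_1$; for $1\le i<n+p$, an edge labelled $g_i$ from $v_i$ to $v_{i+1}$; and an edge labelled $g_{n+p}$ from $v_{n+p}$ to $v_{n+1}$; (2) for $n+1\le i\le n+p$ and $0\le k<g_i$, an edge labelled $k$ from $v'_i$ to $v_1$; for $n+1\le i<n+p$, an edge labelled $g_i$ from $v'_i$ to $v'_{i+1}$; and an edge labelled $g_{n+p}$ from $v'_{n+p}$ to $v'_{n+1}$; (3) the same edges as in (2) with $v''$ in place of $v'$.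
   Context: Let $\beta>1$. For $t\in[0,1]$ put $r_1(t)=\langle\beta t\rangle$, $x_1(t)=\lfloor\beta t\rfloor$, $r_n(t)=\langle\beta r_{n-1}(t)\rangle$, $x_n(t)=\lfloor\beta r_{n-1}(t)\rfloor$ ($\lfloor\cdot\rfloor$ integer part, $\langle\cdot\rangle$ fractional part). The sequence $x_1(t)x_2(t)\cdots$ is the $\beta$-expansion of $t$, and $e(\beta)$ is the $\beta$-expansion of $1$; it is finite if its terms are eventually $0$. The generating sequence is $g(\beta)=e(\beta)$ if $e(\beta)$ is not finite, and $g(\beta)=(a_1\cdots a_{k-1}(a_k-1))^\infty$ if $e(\beta)=a_1\cdots a_k00\cdots$ with $a_k\ne0$. The beta-shift $\mathsf{X}_\beta$ is the two-sided shift space whose language is the set of finite factors of $\beta$-expansions of $t\in[0,1)$; equivalently (Rényi) it consists of the $x\in\{0,\ldots,\lceil\beta\rceil-1\}^{\mathbb{Z}}$ with $x_kx_{k+1}\cdots\le g(\beta)$ lexicographically for all $k\in\mathbb{Z}$. It is irreducible, and sofic when $g(\beta)$ is eventually periodic. The right Fischer cover $(F,\mathcal{L}_F)$ of an irreducible sofic shift is its right-resolving presentation (labelled graph whose biinfinite paths have label sequences exactly the elements of the shift, no vertex emitting two edges with the same label) with the minimal number of vertices, unique up to isomorphism. The (right) fiber product graph is the labelled graph with vertex set $\{(u,v)\mid u,v\in F^0\}$ and an edge labelled $a$ from $(u_1,v_1)$ to $(u_2,v_2)$ iff $F$ has edges labelled $a$ from $u_1$ to $u_2$ and from $v_1$ to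 $v_2$. The fiber product cover is the maximal essential subgraph of the fiber product graph (essential: every vertex emits and receives an edge). *)

(* Defs.v *)
From HB Require Import structures.
From mathcomp Require Import all_boot all_order all_algebra.
From mathcomp Require Import boolp classical_sets reals.

Set Implicit Arguments.
Unset Strict Implicit.
Unset Printing Implicit Defensive.

Import Order.TTheory GRing.Theory Num.Theory.
Local Open Scope classical_set_scope.
Local Open Scope ring_scope.

(* One-sided sequences are indexed from 0: [s k] is the term s_(k+1) of the
   mathematical text. *)

Section BetaExpansion.
Variables (R : realType) (beta : R).

(* For t >= 0 and beta > 0, [Num.truncn] is applied to nonnegative numbers
   only, where it is the integer part; r_0(t) = t. *)
Fixpoint beta_rem (t : R) (k : nat) : R :=
  if k is k'.+1 then
    let y := beta * beta_rem t k' in y - (Num.truncn y)%:R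
  else t.

Definition beta_expansion (t : R) (k : nat) : nat :=
  Num.truncn (beta * beta_rem t k).

Definition finite_expansion (s : nat -> nat) : Prop :=
  exists N, forall i, (N <= i)%N -> s i = 0%N.

Definition last_nonzero (s : nat -> nat) (k : nat) : Prop :=
  s k <> 0%N /\ forall i, (k < i)%N -> s i = 0%N.

Definition generating_sequence : nat -> nat :=
  let e := beta_expansion 1 in
  if `[< finite_expansion e >] then
    let k := xget 0%N [set k | last_nonzero e k] in
    fun i => let j := (i %% k.+1)%N in if j == k then (e k).-1 else e j
  else e.

Definition factors (s : nat -> nat) : set (seq nat) :=
  [set w | exists j : nat, w = mkseq (fun i => s (j + i)%N) (size w)].

Definition beta_language : set (seq nat) :=
  [set w | exists t : R, [/\ 0 <= t, t < 1 & factors (beta_expansion t) w]].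

(* A shift space consists of exactly the points all of whose finite blocks lie
   in its language. *)
Definition beta_shift : set (int -> nat) :=
  [set x | forall (k : int) (m : nat),
     beta_language (mkseq (fun i => x (k + i%:Z)) m)].

End BetaExpansion.

Definition periodic (s : nat -> nat) : Prop :=
  exists2 p : nat, (0 < p)%N & forall i, s (i + p)%N = s i.

(* s = s_1 ... s_n (s_(n+1) ... s_(n+p))^infinity *)
Definition preperiod_period (s : nat -> nat) (n p : nat) : Prop :=
  (0 < p)%N /\ forall i, (n <= i)%N -> s (i + p)%N = s i.

Definition eventually_periodic (s : nat -> nat) : Prop :=
  exists n p, preperiod_period s n p.

Definition minimal_preperiod_period (s : nat -> nat) (n p : nat) : Prop :=
  preperiod_period s n p /\
  forall n' p', preperiod_period s n' p' -> (n <= n')%N /\ (p <= p')%N.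

(* Edges are identified with triples (source, label, target): in a
   right-resolving graph no two edges share all three. *)
Record lgraph (A : Type) := LGraph {
  vertex : finType;
  edge : vertex -> A -> vertex -> Prop }.

Section LabelledGraphs.
Variable A : Type.
Implicit Types G H : lgraph A.

Definition right_resolving G : Prop :=
  forall (u : vertex G) a v w, edge u a v -> edge u a w -> v = w.

Definition presents G (X : set (int -> A)) : Prop :=
  forall x : int -> A,
    X x <-> exists s : int -> vertex G, forall k, edge (s k) (x k) (s (k + 1)).

Definition right_fischer_cover G (X : set (int -> A)) : Prop :=
  [/\ right_resolving G, presents G X &
      forall H, right_resolving H -> presents H X ->
        (#|vertex G| <= #|vertex H|)%N].

Definition essential G : Prop :=
  forall u : vertex G,
    (exists a v, edge u a v) /\ (exists a v, edge v a u).

Definition lgraph_iso G H : Prop :=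
  exists2 f : vertex G -> vertex H, bijective f &
    forall u a v, edge u a v <-> edge (f u) a (f v).

Definition fiber_product G : lgraph A :=
  @LGraph A (vertex G * vertex G)%type
    (fun u a v => edge u.1 a v.1 /\ edge u.2 a v.2).

Record subgraph G := Subgraph {
  sub_vertex : {set vertex G};
  sub_edge : vertex G -> A -> vertex G -> Prop;
  sub_edgeP : forall u a v, sub_edge u a v ->
    [/\ u \in sub_vertex, v \in sub_vertex & edge u a v] }.

Definition lgraph_of_subgraph G (S : subgraph G) : lgraph A :=
  @LGraph A {u : vertex G | u \in sub_vertex S}
    (fun u a v => sub_edge S (val u) a (val v)).

Definition subgraph_le G (S T : subgraph G) : Prop :=
  sub_vertex S \subset sub_vertex T /\
  forall u a v, sub_edge S u a v -> sub_edge T u a v.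

Definition maximal_essential_subgraph G (S : subgraph G) : Prop :=
  essential (lgraph_of_subgraph S) /\
  forall T : subgraph G, essential (lgraph_of_subgraph T) ->
    subgraph_le S T -> subgraph_le T S.

Definition fiber_product_cover G (C : subgraph (fiber_product G)) : Prop :=
  maximal_essential_subgraph C.

End LabelledGraphs.

Section ExplicitCover.
Variables (g : nat -> nat) (n p : nat).

Definition cover_vertex : finType := ('I_(n + p) + bool * 'I_p)%type.

(* [vtx i] is v_(i+1); [vtx' false i] is v'_(n+1+i) and [vtx' true i] is
   v''_(n+1+i). *)
Definition vtx (i : 'I_(n + p)) : cover_vertex := inl i.
Definition vtx' (b : bool) (i : 'I_p) : cover_vertex := inr (b, i).

Inductive cover_edge : cover_vertex -> nat -> cover_vertex -> Prop :=
| edge_reset (i j : 'I_(n + p)) (k : nat) :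
    (k < g i)%N -> j = 0%N :> nat -> cover_edge (vtx i) k (vtx j)
| edge_next (i j : 'I_(n + p)) :
    j = i.+1 :> nat -> cover_edge (vtx i) (g i) (vtx j)
| edge_loop (i j : 'I_(n + p)) :
    i.+1 = (n + p)%N -> j = n :> nat -> cover_edge (vtx i) (g i) (vtx j)
| edge_reset' (b : bool) (i : 'I_p) (j : 'I_(n + p)) (k : nat) :
    (k < g (n + i))%N -> j = 0%N :> nat -> cover_edge (vtx' b i) k (vtx j)
| edge_next' (b : bool) (i j : 'I_p) :
    j = i.+1 :> nat -> cover_edge (vtx' b i) (g (n + i)%N) (vtx' b j)
| edge_loop' (b : bool) (i j : 'I_p) :
    i.+1 = p -> j = 0%N :> nat -> cover_edge (vtx' b i) (g (n + i)%N) (vtx' b j).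

Definition explicit_cover : lgraph nat := LGraph cover_edge.

End ExplicitCover.

(* Main.v *)
(* Write [g] for the generating sequence and [r_i] for the [i]-th remainder of
   1. Reading digits greedily, vertex [v_(i+1)] of the expected Fischer cover
   stands for the interval [[0, r_i[: the words read from it are the prefixes of
   the expansions of its points. The resulting graph on [n + p] vertices presents
   the shift, is strongly connected and separates follower sets, which identifies
   every minimal right-resolving presentation with it.

   A vertex of the fiber product cover is a pair of vertices with a common
   infinite past. A walk that has just entered [v_1] reads [g] until its next
   return to [v_1], and as [g] dominates its tails no other walk on the same word
   can return to [v_1] in between. Hence off the diagonal one of the two walks
   has been in the loop [v_(n+1) ... v_(n+p)] forever, while the other one has
   returned to [v_1] infinitely often; the latter is then determined by the
   phase of the former. Such a second walk exists for each phase because [g] is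
   not periodic: this gives the [v'] and, by symmetry, the [v'']. *)

Require Import Defs.
From HB Require Import structures.
From mathcomp Require Import all_boot all_order all_algebra.
From mathcomp Require Import boolp classical_sets filter reals.
From mathcomp Require Import zify.

Set Implicit Arguments.
Unset Strict Implicit.
Unset Printing Implicit Defensive.

Import Order.TTheory GRing.Theory Num.Theory.
Local Open Scope ring_scope.

(** * Labelled graphs and minimal presentations *)

Section LabelledGraphTheory.
Variable A : Type.
Implicit Types G H : lgraph A.

Fixpoint walk G (u : vertex G) (w : seq A) (v : vertex G) : Prop :=
  if w is a :: w' then exists2 u', edge u a u' & walk u' w' v else u = v.

Definition follower G (u : vertex G) (y : nat -> A) : Prop :=
  exists2 s : nat -> vertex G,
    s 0%N = u & forall k, edge (s k) (y k) (s k.+1).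

Definition past G (s : nat -> vertex G) (x : nat -> A) : Prop :=
  forall k, edge (s k.+1) (x k) (s k).

Definition scons (a : A) (y : nat -> A) (k : nat) : A :=
  if k is k'.+1 then y k' else a.

Lemma walk_cat G (u v : vertex G) w1 w2 :
  walk u (w1 ++ w2) v <-> exists2 u', walk u w1 u' & walk u' w2 v.
Proof.
elim: w1 u => [|a w1 IH] u /=.
  by split=> [uv|[_ <- //]]; exists u.
split=> [[u' uu' /IH[u'' h1 h2]]|[u'' [u' uu' h1] h2]].
  by exists u'' => //; exists u'.
by exists u' => //; apply/IH; exists u''.
Qed.

Lemma walk_det G (u v v' : vertex G) w : right_resolving G ->
  walk u w v -> walk u w v' -> v = v'.
Proof.
move=> rr; elim: w u => [|a w IH] u /=; first by move=> <-.
by move=> [u1 e1 h1] [u2 e2 h2]; apply: (IH u1) => //; rewrite (rr _ _ _ _ e1 e2).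
Qed.

Lemma walk_mkseq G (s : nat -> vertex G) (y : nat -> A) m :
  (forall k, (k < m)%N -> edge (s k) (y k) (s k.+1)) ->
  walk (s 0%N) (mkseq y m) (s m).
Proof.
elim: m => [//|m IH] h.
rewrite /mkseq -addn1 iotaD map_cat addn1; apply/walk_cat; exists (s m).
  by apply: IH => k km; apply: h; lia.
by exists (s m.+1) => //; apply: h.
Qed.

(** Right-resolution makes the walk on each prefix unique, so the endpoints chosen for successive
    prefixes are joined by edges. *)
Lemma follower_walks G (u : vertex G) y : right_resolving G ->
  (forall m, exists v, walk u (mkseq y m) v) -> follower u y.
Proof.
move=> rr /choice[s hs]; exists s; first by have /= := hs 0%N.
move=> k; have := hs k.+1.
rewrite /mkseq -addn1 iotaD map_cat addn1.
move=> /walk_cat[u' h1 /= [u2 h2 <-]].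
by rewrite (walk_det rr (hs k) h1).
Qed.

Lemma walk_follower G (u : vertex G) y m : follower u y ->
  exists v, walk u (mkseq y m) v.
Proof. by move=> [s <- h]; exists (s m); apply: walk_mkseq. Qed.

Lemma follower_scons G (u : vertex G) a y :
  follower u (scons a y) <-> exists2 v, edge u a v & follower v y.
Proof.
split=> [[s <- h]|[v uv [s sv h]]].
  by exists (s 1%N); [exact: (h 0%N)|exists (s \o succn) => // k; apply: (h k.+1)].
exists (fun k => if k is k'.+1 then s k' else u) => // -[|k] /=; last exact: h.
by rewrite sv.
Qed.

Lemma follower_edge G (u v : vertex G) a y : right_resolving G ->
  edge u a v -> follower v y <-> follower u (scons a y).
Proof.
move=> rr uv; split=> [h|/follower_scons[v' uv' h]].
  by apply/follower_scons; exists v.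
by rewrite (rr _ _ _ _ uv uv').
Qed.

Definition same_followers G H (u : vertex G) (v : vertex H) : Prop :=
  forall y, follower u y <-> follower v y.

Definition follower_separated G : Prop :=
  forall u v : vertex G, same_followers u v -> u = v.

(** A follower [y] of [v] makes [scons a y] a follower of [u], hence of [u'], which yields the edge
    out of [u']; determinism then matches all other followers. *)
Lemma same_followers_edge G H (u v : vertex G) (u' : vertex H) a :
  right_resolving G -> right_resolving H -> (exists y, follower v y) ->
  same_followers u u' -> edge u a v ->
  exists2 v', edge u' a v' & same_followers v v'.
Proof.
move=> rG rH [y vy] uu' uv.
have /(follower_edge _ rG uv)/uu'/follower_scons[v' uv' _] := vy.
exists v' => // z; split.
  by move=> /(follower_edge _ rG uv)/uu'/(follower_edge _ rH uv').
by move=> /(follower_edge _ rH uv')/uu'/(follower_edge _ rG uv).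
Qed.

Lemma same_followers_walk G H (u v : vertex G) (u' : vertex H) w :
  right_resolving G -> right_resolving H ->
  (forall v : vertex G, exists y, follower v y) ->
  same_followers u u' -> walk u w v -> exists v' : vertex H, same_followers v v'.
Proof.
move=> rG rH ne; elim: w u u' => [|a w IH] u u' uu' /=.
  by move=> <-; exists u'.
move=> [u1 uu1]; have [v' _ h] := same_followers_edge rG rH (ne u1) uu' uu1.
exact: IH h.
Qed.

Lemma same_followers_iso G H (f : vertex G -> vertex H) :
  right_resolving G -> right_resolving H ->
  (forall v : vertex G, exists y, follower v y) -> follower_separated G ->
  bijective f -> (forall u, same_followers u (f u)) ->
  forall u a v, edge u a v <-> edge (f u) a (f v).
Proof.
move=> rG rH ne sep [f' fK f'K] hf u a v; split=> uv.
  have [v' uv' h] := same_followers_edge rG rH (ne v) (hf u) uv.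
  suff -> : v = f' v' by rewrite f'K.
  by apply: sep => y; rewrite h (hf (f' v')) f'K.
have neH : exists y, follower (f v) y by have [y /hf] := ne v; exists y.
have hf' : same_followers (f u) u by move=> y; rewrite -hf.
have [v' uv' h] := same_followers_edge rH rG neH hf' uv.
suff -> : v = v' by [].
by apply: sep => y; rewrite -h hf.
Qed.

(** * Comparison of a presentation with a minimal one *)

Section Presentations.
Variables (X : set (int -> A)) (G H : lgraph A) (o : vertex G) (z : A).
Hypotheses (rG : right_resolving G) (rH : right_resolving H).
Hypotheses (pG : presents G X) (pH : presents H X).
Hypothesis oo : edge o z o.
Hypothesis to_o : forall u : vertex G, exists w, walk u w o.
Hypothesis from_o : forall u : vertex G, exists w, walk o w u.
Hypothesis block_o : forall (x : int -> A) m, X x ->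
  exists v, walk o (mkseq (fun i => x i%:Z) m) v.

(** The past and [y] glue to a point of [X], whose blocks from position 0 on are readable from [o]
    by [block_o]. *)
Lemma follower_past_o (q : vertex H) (s : nat -> vertex H) x y :
  past s x -> follower (s 0%N) y -> follower o y.
Proof.
move=> ps [t t0 ty]; apply: follower_walks => // m.
(* [Negz k] is -(k+1), the position of the label [x k] of the past. *)
pose xx (k : int) := match k with Posz k => y k | Negz k => x k end.
suff /(block_o m)[v hv] : X xx by exists v.
apply/pH; exists (fun k => match k with Posz k => t k | Negz k => s k.+1 end).
move=> [k|[|k]]; first by rewrite (_ : Posz k + 1 = Posz k.+1); [apply: ty|lia].
  by have -> : Negz 0 + 1 = Posz 0 by []; rewrite t0; exact: ps.
by have -> : Negz k.+1 + 1 = Negz k by lia; exact: ps.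
Qed.

(** The default value [z] continues the word beyond its end by turning round the loop [oo]. *)
Lemma walk_follower_o (u : vertex G) w : walk u w o -> follower u (nth z w).
Proof.
elim: w u => [|a w IH] u /=.
  by move=> ->; exists (fun=> o) => // k; rewrite nth_nil.
move=> [u' uu' /IH h].
have -> : nth z (a :: w) = scons a (nth z w) by apply/funext => -[].
by apply/follower_scons; exists u'.
Qed.

Lemma follower_nonempty (u : vertex G) : exists y, follower u y.
Proof. by have [w /walk_follower_o] := to_o u; exists (nth z w). Qed.

Definition has_past (q : vertex H) : Prop :=
  exists s x, s 0%N = q /\ past s x.

Lemma has_past_walk q w q' : has_past q -> walk q w q' -> has_past q'.
Proof.
elim: w q => [|a w IH] q /=; first by move=> ? <-.
move=> [s [x [sq ps]]] [q1 qq1]; apply: IH.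
exists (fun k => if k is k'.+1 then s k' else q1), (scons a x); split=> //.
by move=> [|k] /=; [rewrite sq|apply: ps].
Qed.

(** The word padded with [z] on both sides is a point of [X], so a biinfinite path of [H] carries
    it. *)
Lemma o_word_in_H w : walk o w o ->
  exists q q' : vertex H, has_past q /\ walk q w q'.
Proof.
move=> /walk_follower_o[s s0 hs].
pose x (k : int) := match k with Posz k => nth z w k | Negz k => z end.
have /pH[t ht] : X x.
  apply/pG; exists (fun k => match k with Posz k => s k | Negz k => o end).
  move=> [k|[|k]]; first by rewrite (_ : Posz k + 1 = Posz k.+1); [apply: hs|lia].
    by have -> : Negz 0 + 1 = Posz 0 by []; rewrite s0.
  by have -> : Negz k.+1 + 1 = Negz k by lia.
exists (t 0), (t (size w)%:Z); split.
  exists (fun k => t (- k%:Z)), (fun k => x (- k.+1%:Z)); split=> // k.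
  have := ht (- k.+1%:Z); suff -> : - k.+1%:Z + 1 = - k%:Z by [].
  lia.
rewrite -[X in walk _ X _](mkseq_nth z).
apply: (walk_mkseq (s := fun k : nat => t k%:Z)) => k _.
by have := ht k; suff -> : k%:Z + 1 = k.+1%:Z by []; lia.
Qed.

(* If no vertex of [H] had the followers of [o], one could extend a loop at [o]
   so as to make it unreadable from one further vertex of [H] at a time, and
   end up with a word of the shift that [H] does not read. *)
Lemma same_followers_o : exists q : vertex H, same_followers o q.
Proof.
apply: contrapT => /forallNP no.
have kill (qs : seq (vertex H)) : exists2 w, walk o w o &
    forall q, q \in qs -> has_past q -> forall v, ~ walk q w v.
  elim: qs => [|q qs [w wo hw]]; first by exists [::].
  have [[q1 [qw pq]]|nq] := pselect (exists q1, walk q w q1 /\ has_past q).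
    have [s [x [sq ps]]] := has_past_walk pq qw.
    have [y oy nqy] : exists2 y, follower o y & ~ follower q1 y.
      apply: contrapT => /forall2NP h; apply: (no q1) => y; split.
        by have [//|/contrapT] := h y.
      by rewrite -sq; apply: follower_past_o ps.
    have [m hm] : exists m, forall v, ~ walk q1 (mkseq y m) v.
      apply: contrapT => /forallNP h; apply: nqy; apply: follower_walks => // m.
      by have /existsNP[v /contrapT hv] := h m; exists v.
    have [v hv] := walk_follower m oy; have [w' hw'] := to_o v.
    exists (w ++ mkseq y m ++ w').
      by apply/walk_cat; exists o => //; apply/walk_cat; exists v.
    move=> q2; rewrite inE => /orP[/eqP ->|q2qs] pq2 v2 /walk_cat[q3 h1 h2].
      move/walk_cat: h2 => [q4 h2 _].
      by apply: (hm q4); rewrite (walk_det rH qw h1).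
    exact: (hw q2 q2qs pq2 q3).
  exists w => // q2; rewrite inE => /orP[/eqP ->|]; last exact: hw.
  by move=> pq v qv; apply: nq; exists v.
have [w wo hw] := kill (enum (vertex H)).
have [q [q' [pq qw]]] := o_word_in_H wo.
by apply: hw qw; rewrite ?mem_enum.
Qed.

(** Walks from [o] transport the vertex of [H] matching [o] to one matching each vertex of [G];
    separation makes this map injective, and the cardinalities make it bijective. *)
Lemma right_resolving_minimal_iso : follower_separated G ->
  (#|vertex H| <= #|vertex G|)%N ->
  exists2 f : vertex G -> vertex H, bijective f &
    forall u a v, edge u a v <-> edge (f u) a (f v).
Proof.
move=> sep cHG; have [q oq] := same_followers_o.
have /choice[f hf] : forall u : vertex G, exists q, same_followers u (q : vertex H).
  move=> u; have [w ow] := from_o u.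
  exact: same_followers_walk (follower_nonempty) oq ow.
have fbij : bijective f.
  apply: inj_card_bij => // u v fuv; apply: sep => y.
  by rewrite (hf u) (hf v) fuv.
by exists f => //; apply: same_followers_iso => //; apply: follower_nonempty.
Qed.

End Presentations.

Lemma right_fischer_cover_iso X G F (o : vertex G) (z : A) :
  right_resolving G -> presents G X -> edge o z o ->
  (forall u : vertex G, exists w, walk u w o) ->
  (forall u : vertex G, exists w, walk o w u) ->
  (forall x m, X x -> exists v, walk o (mkseq (fun i => x i%:Z) m) v) ->
  follower_separated G -> right_fischer_cover F X ->
  exists2 f : vertex G -> vertex F, bijective f &
    forall u a v, edge u a v <-> edge (f u) a (f v).
Proof.
move=> rG pG oo to_o from_o block_o sep [rF pF minF].
exact: (right_resolving_minimal_iso rG rF pG pF oo) (minF G rG pG).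
Qed.


(** * Pasts and maximal essential subgraphs *)

Lemma essential_past G (u : vertex G) : essential G ->
  exists s x, s 0%N = u /\ @past G s x.
Proof.
move=> eG; have /choice[pr hpr] v : exists ua : vertex G * A, edge ua.1 ua.2 v.
  by have [_ [a [u' h]]] := eG v; exists (u', a).
exists (fun k => iter k (fst \o pr) u), (fun k => (pr (iter k (fst \o pr) u)).2).
by split=> // k; apply: hpr.
Qed.

(** The image of [psi] induces an essential subgraph [T]. Each vertex of [C] ends a past, so it lies
    in the image; thus [C] is contained in [T], and maximality makes them equal. *)
Lemma maximal_essential_subgraph_iso (P K : lgraph A)
    (psi : vertex K -> vertex P) (C : subgraph P) :
  injective psi -> (forall u a v, edge u a v <-> edge (psi u) a (psi v)) ->
  essential K ->
  (forall s x, @past P s x -> exists c, psi c = s 0%N) ->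
  maximal_essential_subgraph C -> lgraph_iso (lgraph_of_subgraph C) K.
Proof.
move=> psi_inj psi_edge eK pastP [eC maxC].
pose I : {set vertex P} := [set psi c | c in vertex K].
have inI c : psi c \in I by apply: imset_f.
pose T : subgraph P := @Subgraph A P I
  (fun u a v => [/\ u \in I, v \in I & edge u a v]) (fun _ _ _ h => h).
have eT : essential (lgraph_of_subgraph T).
  move=> [u uI]; have /imsetP[c _ uc] := uI.
  have [[a [d cd]] [b [e ec]]] := eK c.
  split; [exists a, (exist _ (psi d) (inI d))|exists b, (exist _ (psi e) (inI e))].
    by split=> //=; rewrite uc; apply/psi_edge.
  by split=> //=; rewrite uc; apply/psi_edge.
have CI u : u \in sub_vertex C -> u \in I.
  move=> uC; have [s [x [s0 ps]]] :=
    @essential_past (lgraph_of_subgraph C) (exist _ u uC) eC.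
  have [|c hc] := pastP (fun k => val (s k)) x.
    by move=> k; have [] := sub_edgeP (ps k).
  by rewrite s0 /= in hc; rewrite -hc inI.
have [|TC TCe] := maxC T eT.
  split; first by apply/fintype.subsetP => u; apply: CI.
  by move=> u a v uv; have [uC vC e] := sub_edgeP uv; split; rewrite ?CI.
have inC c : psi c \in sub_vertex C by apply: (fintype.subsetP TC).
have /choice[f hf] (u : vertex (lgraph_of_subgraph C)) :
    exists c, psi c = val u.
  by have /imsetP[c _ ->] := CI _ (valP u); exists c.
exists f.
  exists (fun c => exist _ (psi c) (inC c)) => [u|c].
    by apply: val_inj; rewrite /= hf.
  by apply: psi_inj; rewrite hf.
move=> u a v; split=> [uv|/psi_edge].
  by apply/psi_edge; rewrite !hf; have [] := sub_edgeP uv.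
rewrite !hf => uv; apply: TCe; split=> //; exact/CI/valP.
Qed.

Lemma fiber_product_embedding (G F K : lgraph A)
    (f : vertex G -> vertex F) (psi : vertex K -> vertex (fiber_product G)) :
  bijective f -> (forall u a v, edge u a v <-> edge (f u) a (f v)) ->
  injective psi -> (forall u a v, edge u a v <-> edge (psi u) a (psi v)) ->
  (forall s x, @past (fiber_product G) s x -> exists c, psi c = s 0%N) ->
  exists phi : vertex K -> vertex (fiber_product F),
  [/\ injective phi, forall u a v, edge u a v <-> edge (phi u) a (phi v) &
      forall s x, @past (fiber_product F) s x -> exists c, phi c = s 0%N].
Proof.
move=> [f' fK f'K] f_edge psi_inj psi_edge psi_past.
exists (fun c => (f (psi c).1, f (psi c).2)); split.
- move=> c d [/(can_inj fK) e /(can_inj fK) e']; apply: psi_inj.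
  by rewrite [LHS]surjective_pairing e e' -surjective_pairing.
- by move=> u a v; rewrite psi_edge /= !f_edge.
move=> s x ps.
have [|c hc] := psi_past (fun k => (f' (s k).1, f' (s k).2)) x.
  by move=> k; have [] := ps k; rewrite /= !f_edge !f'K.
by exists c; rewrite hc /= !f'K -surjective_pairing.
Qed.

End LabelledGraphTheory.

Lemma mkseq_succ (T : Type) (f : nat -> T) m :
  mkseq f m.+1 = f 0%N :: mkseq (f \o succn) m.
Proof. by rewrite /mkseq /= -[1%N]/(1 + 0)%N iotaDl -map_comp. Qed.

(* Each [s k] is the limit of the [S m k] along an ultrafilter on [nat]. *)
Lemma chain_compactness (V : finType) (E : int -> V -> V -> Prop)
    (S : nat -> int -> V) :
  (forall k, exists N, forall m, (N <= m)%N -> E k (S m k) (S m (k + 1))) ->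
  exists s : int -> V, forall k, E k (s k) (s (k + 1)).
Proof.
move=> hE.
have [U [UU leU]] := ultraFilterLemma eventually_filter.
have lim k : exists v, U [set m | S m k = v]%classic.
  apply: contrapT => /forallNP no.
  have : U (fun m => forall v, S m k <> v).
    apply: filter_forall => v.
    by have [/no|] := in_ultra_setVsetC [set m | S m k = v]%classic UU.
  by move=> /filter_ex[m /(_ (S m k))].
have /choice[s hs] := lim.
exists s => k; have [N hN] := hE k.
have leN : U [set m | (N <= m)%N]%classic by apply: leU; exists N.
have FU : Filter U by exact: filter_filter.
have Ukk := @filterI _ U FU _ _ (hs k) (hs (k + 1)).
have /filter_ex[m [[/= <- <-]]] := @filterI _ U FU _ _ Ukk leN.
exact: hN.
Qed.

(** * The graph of an eventually periodic sequence *)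

Section BetaGraph.
Local Open Scope nat_scope.
Variables (g : nat -> nat) (n p : nat).

Definition next_state (i : nat) : nat := if i.+1 == n + p then n else i.+1.

(** State [i] stands for v_(i+1), so 0 is v_1. The value is meaningful only for [a <= g i], which
    the edges of [beta_graph] require. *)
Definition step (i a : nat) : nat := if a < g i then 0 else next_state i.

Definition beta_graph : lgraph nat :=
  @LGraph nat 'I_(n + p) (fun i a j => a <= g i /\ j = step i a :> nat).

Definition same_tail (i j : nat) : Prop := forall m, g (i + m) = g (j + m).

(* The words read from [i] in the infinite version of the graph, on [nat], in
   which the periodic part of [g] is unfolded. *)
Fixpoint readable (i : nat) (w : seq nat) : bool :=
  if w is a :: w' then (a <= g i) && readable (if a < g i then 0 else i.+1) w'
  else true.

Hypotheses (n_gt0 : 0 < n) (p_gt0 : 0 < p).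
Hypothesis g_per : forall i, n <= i -> g (i + p) = g i.
(** This is the form in which the minimality of [n] and [p] enters. *)
Hypothesis tail_inj : forall i j,
  i < n + p -> j < n + p -> same_tail i j -> i = j.
Hypothesis g_aper : forall m, 0 < m -> ~ forall i, g (i + m) = g i.
Hypothesis g0_gt0 : 0 < g 0.
Hypothesis g_nz : forall i, exists k, 0 < g (i + k).

(** This stands in for Parry's condition that no tail of [g] exceeds [g]; for the expansion of 1 it
    holds because no remainder exceeds 1. *)
Hypothesis readable_origin : forall i w, readable i w -> readable 0 w.

Notation G := beta_graph.
Notation V := (vertex beta_graph).

Lemma np_gt0 : 0 < n + p. Proof. by rewrite addn_gt0 n_gt0. Qed.

Definition origin : V := Ordinal np_gt0.

Lemma next_state_lt i : i < n + p -> next_state i < n + p.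
Proof. by rewrite /next_state; case: ifP => h; lia. Qed.

Lemma step_lt (i : V) a : step i a < n + p.
Proof.
rewrite /step; case: ifP => _; [exact: np_gt0|exact/next_state_lt/ltn_ord].
Qed.

Definition step_vertex (i : V) a : V := Ordinal (step_lt i a).

Lemma next_state_gt0 i : 0 < next_state i.
Proof. by rewrite /next_state; case: ifP. Qed.

Lemma same_tail_next i : same_tail (next_state i) i.+1.
Proof.
move=> m; rewrite /next_state; case: eqP => [->|//].
by rewrite addnAC g_per ?leq_addr.
Qed.

Lemma beta_graph_edge (u v : V) a : a <= g u -> v = step u a :> nat ->
  edge u a v.
Proof. by []. Qed.

Lemma edge_step_vertex (u : V) a : a <= g u -> edge u a (step_vertex u a).
Proof. by []. Qed.

Lemma edge_le (u v : V) a : edge u a v -> a <= g u.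
Proof. by case. Qed.

Lemma edge_eq0 (u v : V) a : edge u a v -> (v == 0 :> nat) = (a < g u).
Proof.
move=> [h ->]; rewrite /step; case: ifP => // _.
by have := next_state_gt0 u; case: next_state.
Qed.

Lemma edge_neq0 (u v : V) a : edge u a v -> v != 0 :> nat ->
  a = g u /\ v = next_state u :> nat.
Proof.
move=> e; rewrite (edge_eq0 e); case: e => h ->; rewrite /step.
by case: ltnP => // h2 _; split=> //; apply/eqP; rewrite eqn_leq h.
Qed.

Lemma right_resolving_beta_graph : right_resolving G.
Proof. by move=> u a v w [_ hv] [_ hw]; apply: val_inj; rewrite /= hv hw. Qed.

(** A state and an unfolded position with the same tail of [g] admit the same symbols, and stay so
    related after each step. *)
Lemma readable_walk (u : V) i w : same_tail u i ->
  readable i w <-> exists v, walk u w v.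
Proof.
elim: w u i => [|a w IH] u i ui /=; first by split=> // _; exists u.
have gi : g u = g i by have := ui 0; rewrite !addn0.
have st : same_tail (step_vertex u a) (if a < g i then 0 else i.+1).
  rewrite /= /step gi; case: ifP => _ // m.
  by rewrite same_tail_next !addSnnS ui.
split=> [/andP[ai /(IH _ _ st)[v hv]]|[v [u' e hv]]].
  by exists v, (step_vertex u a); [apply: edge_step_vertex; rewrite gi|].
have -> /= : a <= g i by rewrite -gi; exact: edge_le e.
apply/(IH _ _ st); exists v; suff -> : step_vertex u a = u' by [].
by apply: val_inj; case: e.
Qed.


Lemma same_tail_refl i : same_tail i i. Proof. by []. Qed.

Lemma readable_tail i m : readable i (mkseq (fun k => g (i + k)) m).
Proof.
elim: m i => [//|m IH] i; rewrite mkseq_succ /= addn0 leqnn ltnn /=.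
by rewrite (eq_mkseq (g := fun k => g (i.+1 + k))) // => k /=; rewrite addSnnS.
Qed.

Lemma readable_le i (y : nat -> nat) m : readable i (mkseq y m.+1) ->
  (forall a, a < m -> y a = g (i + a)) -> y m <= g (i + m).
Proof.
elim: m i y => [|m IH] i y; rewrite mkseq_succ /=; first by rewrite addn0 andbT.
move=> /andP[_ h] yg; have y0 := yg 0 isT; rewrite addn0 in y0.
rewrite y0 ltnn in h; rewrite -addSnnS; apply: (IH _ (y \o succn)) => // a am.
by rewrite addSnnS; apply: yg.
Qed.

(** The tail of [g] at [l] is readable from [l], hence from 0, where a word that has followed [g] so
    far cannot exceed it at the next symbol. *)
Lemma g_max l m : (forall a, a < m -> g (l + a) = g a) -> g (l + m) <= g m.
Proof.
have /readable_le := readable_origin (readable_tail l m.+1).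
exact.
Qed.

Lemma follower_tail (u : V) : follower u (fun k => g (u + k)).
Proof.
apply: follower_walks right_resolving_beta_graph _ => m.
exact/(readable_walk _ (@same_tail_refl u))/readable_tail.
Qed.

(** The tail of [g] at a state is the lexicographically largest sequence readable from it, so states
    with equal follower sets have equal tails. *)
Lemma follower_separated_beta_graph : follower_separated G.
Proof.
have le (u v : V) m : follower v (fun k => g (u + k)) ->
    (forall a, a < m -> g (u + a) = g (v + a)) -> g (u + m) <= g (v + m).
  move=> /(walk_follower m.+1)/(readable_walk _ (@same_tail_refl v)).
  exact: (@readable_le _ (fun k => g (u + k))).
move=> u v uv; apply/val_inj/tail_inj; [exact: ltn_ord u|exact: ltn_ord v|move=> m].
have vu := iffLR (uv _) (follower_tail u).
have uv' := iffRL (uv _) (follower_tail v).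
elim/ltn_ind: m => m IH; apply/eqP; rewrite eqn_leq !le // => a am.
by rewrite IH.
Qed.

(** Zero terms of [g] are passed by reading 0 and moving on; at the first nonzero term the symbol 0
    leads to v_1. *)
Lemma walk_to_origin (u : V) : exists w, walk u w origin.
Proof.
have [k] := g_nz u; elim: k u => [|k IH] u.
  rewrite addn0 => gu; exists [:: 0]; exists origin => //.
  by split=> //=; rewrite /step gu.
move=> gk; have [gu|gu] := posnP (g u); last first.
  exists [:: 0]; exists origin => //; by split=> //=; rewrite /step gu.
have [|w hw] := IH (step_vertex u 0).
  by rewrite /= /step gu ltnn same_tail_next addSnnS.
by exists (0 :: w), (step_vertex u 0) => //; apply: edge_step_vertex.
Qed.

Lemma walk_from_origin (u : V) : exists w, walk origin w u.
Proof.
case: u => i; elim: i => [|i IH] hi.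
  by exists [::]; apply: val_inj.
have [w hw] := IH (ltnW hi).
exists (w ++ [:: g i]); apply/walk_cat; exists (Ordinal (ltnW hi)) => //.
exists (Ordinal hi) => //; split=> //=; rewrite /step ltnn /next_state.
by rewrite ltn_eqF.
Qed.

Lemma origin_loop : edge origin 0 origin.
Proof. by split=> //=; rewrite /step g0_gt0. Qed.

(** * Synchronisation of two walks on the same word *)

Definition forward (M : nat) (s : nat -> V) (y : nat -> nat) : Prop :=
  forall k, k < M -> edge (s k) (y k) (s k.+1).

Lemma forward_det M s t y : forward M s y -> forward M t y -> s 0 = t 0 ->
  s M = t M.
Proof.
elim: M => [//|M IH] hs ht st0; have := ht M (ltnSn M); rewrite -IH //.
- exact: right_resolving_beta_graph (hs M (ltnSn M)).
- by move=> k kM; apply: hs; lia.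
- by move=> k kM; apply: ht; lia.
Qed.

Lemma forward_drop a M s y : forward (a + M) s y ->
  forward M (fun k => s (a + k)) (fun k => y (a + k)).
Proof. by move=> h k kM; rewrite addnS; apply: h; lia. Qed.

Lemma forward_le M M' s y : M' <= M -> forward M s y -> forward M' s y.
Proof. by move=> le h k kM; apply: h; lia. Qed.

(** Without visits to v_1 only edges labelled by [g] are used. The final state is compared through
    [same_tail], because the walk may have gone round the loop. *)
Lemma forward_advance M s y : forward M s y ->
  (forall a, 0 < a <= M -> s a != 0 :> nat) ->
  same_tail (s M) (s 0 + M) /\ forall a, a < M -> y a = g (s 0 + a).
Proof.
elim: M => [|M IH] hs nz; first by rewrite addn0.
have [|a aM|st ya] := IH; [exact: forward_le hs|by apply: nz; lia|].
have [yM sM] := edge_neq0 (hs M (ltnSn M)) (nz M.+1 (leqnn _)).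
have yM' : y M = g (s 0 + M) by rewrite yM; have := st 0; rewrite !addn0.
split=> [m|a]; last by rewrite ltnS leq_eqVlt => /orP[/eqP ->|/ya].
by rewrite sM same_tail_next addSnnS st; congr g; lia.
Qed.

(* The walk [t] reads [g] from its start, and by [g_max] no walk can read a
   smaller symbol than required while reading a prefix of [g]. *)
Lemma forward_no_reset M s t y : forward M s y -> forward M t y ->
  t 0 = 0 :> nat -> (forall a, 0 < a <= M -> t a != 0 :> nat) ->
  forall a, 0 < a <= M -> s a != 0 :> nat.
Proof.
elim: M => [|M IH] hs ht t0 tnz; first by move=> a; lia.
have hs' : forward M s y by exact: forward_le hs.
have ht' : forward M t y by exact: forward_le ht.
have tnz' a : 0 < a <= M -> t a != 0 :> nat by move=> h; apply: tnz; lia.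
have snz' := IH hs' ht' t0 tnz'.
have [stt yt] := forward_advance ht' tnz'; have [sts ys] := forward_advance hs' snz'.
rewrite t0 in stt yt.
move=> a; case: (ltngtP a M.+1) => [aM h|aM|-> _]; [apply: snz'; lia|lia|].
rewrite (edge_eq0 (hs M (ltnSn M))) -leqNgt.
have [-> _] := edge_neq0 (ht M (ltnSn M)) (tnz M.+1 (leqnn _)).
have := sts 0; have := stt 0; rewrite !addn0 !add0n => -> ->.
by apply: g_max => b bM; rewrite -ys // yt.
Qed.

Lemma forward_reset M s t y : forward M s y -> forward M t y ->
  t 0 = 0 :> nat -> s M = 0 :> nat -> t M = 0 :> nat.
Proof.
move=> hs ht t0 sM; apply/eqP/negPn/negP => tM.
have ex : exists a, (a <= M) && (t a == 0 :> nat) by exists 0; rewrite t0.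
have ub a : (a <= M) && (t a == 0 :> nat) -> a <= M by case/andP.
(* From the last visit [a] of [t] to v_1 on, [forward_no_reset] keeps [s] away from v_1, against
   [sM], unless [a = M]. *)
case: (ex_maxnP ex ub) => a /andP[aM /eqP ta] amax.
have aM' : a < M.
  by rewrite ltn_neqAle aM andbT; apply/eqP => e; rewrite -e ta in tM.
have eM : a + (M - a) = M by lia.
have /forward_drop hs' : forward (a + (M - a)) s y by rewrite eM.
have /forward_drop ht' : forward (a + (M - a)) t y by rewrite eM.
have := forward_no_reset hs' ht'; rewrite addn0 => /(_ ta).
have tnz b : 0 < b <= M - a -> t (a + b) != 0 :> nat.
  move=> bM; apply/eqP => tb; suff : a + b <= a by lia.
  by apply: amax; rewrite tb eqxx andbT; lia.
have Ma : 0 < M - a <= M - a by lia.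
by move=> /(_ tnz _ Ma); rewrite eM sM.
Qed.

(** * Pasts with a common label sequence *)

Lemma past_forward K s x : @past _ G s x ->
  forward K (fun i => s (K - i)) (fun i => x (K - i.+1)).
Proof. by move=> h k kK; have := h (K - k.+1); rewrite -subSn ?subSS. Qed.

Lemma past_forward_sub a b s x : b <= a -> @past _ G s x ->
  forward (a - b) (fun i => s (a - i)) (fun i => x (a - i.+1)).
Proof. by move=> le /(past_forward (K := a)); apply: forward_le; lia. Qed.

Lemma past_det a b s t x : @past _ G s x -> @past _ G t x -> b <= a ->
  s a = t a -> s b = t b.
Proof.
move=> hs ht le; have := forward_det (past_forward_sub le hs) (past_forward_sub le ht).
by rewrite !subn0 subKn.
Qed.

Lemma past_reset a b s t x : @past _ G s x -> @past _ G t x -> b <= a ->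
  t a = 0 :> nat -> s b = 0 :> nat -> t b = 0 :> nat.
Proof.
move=> hs ht le; have := forward_reset (past_forward_sub le hs) (past_forward_sub le ht).
by rewrite !subn0 subKn.
Qed.

Definition resets_unboundedly (s : nat -> V) : Prop :=
  forall a, exists2 b, a <= b & s b = 0 :> nat.

Definition never_resets (s : nat -> V) : Prop := forall k, s k != 0 :> nat.

(** Take a visit [b] of [s] to v_1 and an earlier visit [a] of [t]: [past_reset] puts [t] at v_1 at
    [b] too, and determinism does the rest. *)
Lemma past_unique s t x : @past _ G s x -> @past _ G t x ->
  resets_unboundedly s -> resets_unboundedly t -> s 0 = t 0.
Proof.
move=> hs ht rs rt; have [b _ sb] := rs 0; have [a ba ta] := rt b.
apply: (past_det hs ht (leq0n b)); apply: val_inj.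
by rewrite /= sb (past_reset hs ht ba ta sb).
Qed.

(** Below [n], an edge that is not a reset comes from the preceding index, so a past leading to such
    a state would descend forever. *)
Lemma past_in_loop s x k : @past _ G s x ->
  (forall j, k <= j -> s j != 0 :> nat) -> n <= s k.
Proof.
move=> hs nz; rewrite leqNgt; apply/negP.
have [d] := ubnP (nat_of_ord (s k)).
elim: d k nz => [//|d IH] k nz sd sn.
have [_ e] := edge_neq0 (hs k) (nz k (leqnn k)).
move: e; rewrite /next_state; case: ifP => _ e; first by rewrite e ltnn in sn.
by apply: (IH k.+1) => [j kj||]; [apply: nz|..]; lia.
Qed.

Lemma g_per_modn i a : n <= i -> g (i + a) = g (i + a %% p).
Proof.
move=> ni; rewrite {1}(divn_eq a p); elim: (a %/ p) => [|q IH]; first by rewrite add0n.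
by rewrite -IH mulSn -[RHS]g_per; [congr g; lia|lia].
Qed.

(** Both pasts lie in the loop at [K], and the [p] symbols read since then spell a whole period,
    which determines the tail of [g] and thus the state. *)
Lemma past_no_reset_unique s t x k : @past _ G s x -> @past _ G t x ->
  (forall j, k <= j -> s j != 0 :> nat) ->
  (forall j, k <= j -> t j != 0 :> nat) -> s k = t k.
Proof.
move=> hs ht sz tz; set K := k + p.
have adv r : @past _ G r x -> (forall j, k <= j -> r j != 0 :> nat) ->
    n <= r K /\ forall a, a < p -> x (K - a.+1) = g (r K + a).
  move=> hr rz; split; first by apply: (past_in_loop hr) => j jK; apply: rz; lia.
  have kK : k <= K by lia.
  have := forward_advance (past_forward_sub kK hr).
  rewrite subn0 (_ : K - k = p); last by lia.
  by case=> [a ap|//]; apply: rz; lia.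
have [ns xs] := adv s hs sz; have [nt xt] := adv t ht tz.
apply: (past_det hs ht (leq_addr p k)).
apply/val_inj/tail_inj; [exact: ltn_ord|exact: ltn_ord|move=> m].
by rewrite g_per_modn // [RHS]g_per_modn // -xs ?ltn_pmod // xt ?ltn_pmod.
Qed.

(** Pasts with distinct ends can neither both reset unboundedly nor both have their resets bounded.
    Against a past that resets unboundedly, a single reset of the other would synchronise the
    two. *)
Lemma past_dichotomy s t x : @past _ G s x -> @past _ G t x -> s 0 <> t 0 ->
  (never_resets s /\ resets_unboundedly t) \/
  (never_resets t /\ resets_unboundedly s).
Proof.
move=> hs ht st.
have one u v : @past _ G u x -> @past _ G v x -> u 0 <> v 0 ->
    resets_unboundedly v -> ~ resets_unboundedly u -> never_resets u.
  move=> hu hv uv rv _ k; apply/eqP => uk; apply: uv.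
  have [a ka va] := rv k; apply: (past_det hu hv (leq0n k)); apply: val_inj.
  by rewrite /= uk (past_reset hu hv ka va uk).
have bounded u : ~ resets_unboundedly u ->
    exists K, forall j, K <= j -> u j != 0 :> nat.
  move=> /existsNP[K /forall2NP hK]; exists K => j Kj; apply/eqP => uj.
  by have [] := hK j.
have [rs|rs] := pselect (resets_unboundedly s);
  have [rt|rt] := pselect (resets_unboundedly t).
- by case: st; apply: past_unique hs ht rs rt.
- by right; split=> //; apply: (one t s) => // e; apply: st.
- by left; split=> //; apply: (one s t).
case: st; have [K hK] := bounded s rs; have [K' hK'] := bounded t rt.
apply: (past_det (a := maxn K K') hs ht (leq0n _)).
by apply: (past_no_reset_unique hs ht) => j; rewrite geq_max => /andP[? ?]; auto.
Qed.

(** * Presentation of the shift *)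

Lemma follower_origin y :
  (forall m, readable 0 (mkseq y m)) -> follower origin y.
Proof.
move=> h; apply: follower_walks right_resolving_beta_graph _ => m.
exact/(readable_walk (u := origin) _ (@same_tail_refl 0)).
Qed.

Lemma presents_beta_graph (L : set (seq nat)) :
  (forall w, L w <-> readable 0 w) ->
  presents G [set x | forall (k : int) m, L (mkseq (fun i => x (k + i%:Z)%R) m)]%classic.
Proof.
move=> hL x; split=> /= [hx|[s hs] k m]; last first.
  apply/hL/(@readable_origin (s k))/(readable_walk _ (@same_tail_refl _)).
  exists (s (k + m%:Z)%R).
  have := @walk_mkseq _ G (fun i => s (k + i%:Z)%R) (fun i => x (k + i%:Z)%R) m.
  rewrite addr0; apply=> i _; rewrite (_ : (k + i.+1 = k + i + 1)%R) //; lia.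
have /choice[S hS] m : exists s : nat -> V,
    forall i, edge (s i) (x (- m%:Z + i%:Z)%R) (s i.+1).
  have [|s _ hs] := @follower_origin (fun i => x (- m%:Z + i%:Z)%R).
    by move=> l; apply/hL.
  by exists s.
(* Time [k] is step [k + m] of the walk that starts at [origin] at time [-m]. The absolute value is
   harmless, as only large [m] count in the limit. *)
apply: (chain_compactness (E := fun k u v => @edge _ G u (x k) v)
          (S := fun (m : nat) (k : int) => S m `|(k + m%:Z)%R|)) => k.
exists `|k|%N => m km; have := hS m `|(k + m%:Z)%R|.
rewrite (_ : (- m%:Z + `|(k + m%:Z)%R|%N)%R = k); last by lia.
by rewrite (_ : `|(k + 1 + m%:Z)%R| = `|(k + m%:Z)%R|.+1) //; lia.
Qed.

(** * The loop and its companion walk *)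

Definition phase (k : int) : nat := `|(k %% p%:Z)%Z|.

Lemma phase_lt k : phase k < p.
Proof.
have := ltz_pmod k (d := p%:Z); have := modz_ge0 k (d := p%:Z).
by rewrite /phase; lia.
Qed.

Lemma phase_nat (k : nat) : phase k = k %% p.
Proof. by rewrite /phase modz_nat. Qed.

Lemma phase_small (k : nat) : k < p -> phase k = k.
Proof. by move=> kp; rewrite phase_nat modn_small. Qed.

Lemma phase_addM (k : int) (m : nat) : phase (k + (m * p)%N)%R = phase k.
Proof. by rewrite /phase PoszM addrC modzMDl. Qed.

Lemma phase_succ k : phase (k + 1)%R = (phase k).+1 %% p.
Proof.
have kE : (k %% p%:Z)%Z = phase k :> int.
  by rewrite /phase gez0_abs // modz_ge0 //; lia.
by rewrite {1}/phase -modzDml kE -[(_ + 1)%R]/(Posz (phase k + 1)) modz_nat addn1.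
Qed.

Lemma loop_vertex_lt k : n + phase k < n + p.
Proof. by rewrite ltn_add2l phase_lt. Qed.

Definition loop_vertex (k : int) : V := Ordinal (loop_vertex_lt k).

Lemma loop_vertex_edge k :
  edge (loop_vertex k) (g (n + phase k)) (loop_vertex (k + 1)%R).
Proof.
apply: beta_graph_edge => //=; rewrite /step ltnn /next_state phase_succ.
rewrite -addnS eqn_add2l; case: eqP => [->|ne]; first by rewrite modnn addn0.
by rewrite modn_small //; have := phase_lt k; lia.
Qed.

(** Otherwise let [a] be the time of the last visit to v_1: the word read since then is a prefix of
    [g], and the later terms agree by assumption, so [g] would have period [n + a]. *)
Lemma reset_walk_neq_tail (s : nat -> V) : s 0 = origin ->
  (forall k, edge (s k) (g (n + k)) (s k.+1)) ->
  forall k, ~ same_tail (s k) (n + k).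
Proof.
move=> s0 hs k sk.
have [a [ak sa ga]] : exists a, [/\ a <= k, same_tail (s k) (k - a) &
    forall b, b < k - a -> g (n + a + b) = g b].
  elim: k {sk} => [|k [a [ak sa ga]]].
    by exists 0; split=> //; rewrite s0.
  have := hs k; have [sk e|sk e] := eqVneq (s k.+1 : nat) 0.
    by exists k.+1; split=> //; rewrite subnn // sk.
  have [gk sk'] := edge_neq0 e sk.
  exists a; split; first exact: leqW.
    by move=> m; rewrite sk' same_tail_next addSnnS sa subSn // addSnnS.
  move=> b; rewrite subSn // ltnS leq_eqVlt => /orP[/eqP ->|]; last exact: ga.
  by have := sa 0; rewrite !addn0 => <-; rewrite -gk; congr g; lia.
apply: (@g_aper (n + a)); first by rewrite addn_gt0 n_gt0.
move=> b; rewrite addnC; have [bk|kb] := ltnP b (k - a); first exact: ga.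
have := sa (b - (k - a)); rewrite sk (_ : k - a + _ = b); last by lia.
by move=> <-; congr g; lia.
Qed.

(* The second, non-looping presentation of the periodic point
   [(g_(n+1) ... g_(n+p))^infinity]: a limit of the walks reading it from
   [origin] at ever earlier times. *)
Lemma companion_walk : exists W : int -> V, forall k,
  edge (W k) (g (n + phase k)) (W (k + 1)%R) /\ W k <> loop_vertex k.
Proof.
have [|s s0 hs] := @follower_origin (fun k => g (n + k)).
  by move=> m; apply: (@readable_origin n); apply: readable_tail.
(* The starting times are multiples of [p], so all the walks read the same label at time [k].
   Avoiding the loop vertex is put into the relation so that it survives in the limit. *)
apply: (chain_compactness
  (E := fun k u v => @edge _ G u (g (n + phase k)) v /\ u <> loop_vertex k)
  (S := fun (m : nat) (k : int) => s `|(k + (m * p)%N%:Z)%R|)) => k.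
exists `|k|%N => m km; set q := `|(k + (m * p)%N)%R|.
have qE : q%:Z = (k + (m * p)%N)%R by rewrite /q; nia.
have ph : g (n + phase k) = g (n + q).
  by rewrite -(phase_addM k m) -qE phase_nat -g_per_modn.
split.
  rewrite ph (_ : `|(k + 1 + (m * p)%N)%R| = q.+1); first exact: hs.
  lia.
move=> e; apply: (reset_walk_neq_tail s0 hs (k := q)); rewrite e /= => i.
rewrite -(phase_addM k m) -qE phase_nat -addnA g_per_modn ?leq_addr //.
by rewrite modnDml -g_per_modn // addnA.
Qed.

Lemma past_of_walk (s : int -> V) (x : int -> nat) k :
  (forall k, edge (s k) (x k) (s (k + 1)%R)) ->
  past (fun j : nat => s (k - j%:Z)%R) (fun j => x (k - j.+1%:Z)%R).
Proof.
move=> hs j; have := hs (k - j.+1%:Z)%R.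
by rewrite (_ : (k - j.+1%:Z + 1)%R = (k - j%:Z)%R) //; lia.
Qed.

(** A past that never resets moves backwards round the loop, so its end determines its vertices and
    labels. Hence [t] and [t'] carry the same labels, and [past_unique] applies. *)
Lemma past_off_diagonal s t x s' t' x' :
  @past _ G s x -> @past _ G t x -> @past _ G s' x' -> @past _ G t' x' ->
  never_resets s -> never_resets s' ->
  resets_unboundedly t -> resets_unboundedly t' -> s 0 = s' 0 -> t 0 = t' 0.
Proof.
move=> hs ht hs' ht' zs zs' rt rt' ss0.
have ge r y : @past _ G r y -> never_resets r -> forall k, n <= r k.
  by move=> hr zr k; apply: (past_in_loop hr) => j _; apply: zr.
have ss k : s k = s' k.
  elim: k => // k IH; apply: val_inj.
  have [_ e] := edge_neq0 (hs k) (zs k); have [_ e'] := edge_neq0 (hs' k) (zs' k).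
  move: e e'; rewrite IH => -> /=; rewrite /next_state.
  have := ge s x hs zs k.+1; have := ge s' x' hs' zs' k.+1.
  by case: ifP; case: ifP; move: (ltn_ord (s k.+1)) (ltn_ord (s' k.+1)); lia.
apply: (past_unique ht _ rt rt') => k.
have [-> _] := edge_neq0 (hs k) (zs k); rewrite ss.
by have [<- _] := edge_neq0 (hs' k) (zs' k); apply: ht'.
Qed.

(** [w i] is the state of the resetting walk while the looping one is at v_(n+1+i), which is
    [rshift n i]; [ordS] is the cyclic successor. *)
Lemma companion : exists w : 'I_p -> V,
  [/\ forall i, edge (w i) (g (n + i)) (w (ordS i)),
      forall i, w i <> rshift n i &
      forall s t x, @past _ G s x -> @past _ G t x -> s 0 <> t 0 ->
        exists i, (s 0 = rshift n i /\ t 0 = w i) \/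
                  (s 0 = w i /\ t 0 = rshift n i)].
Proof.
have [W hW] := companion_walk.
have pW k := past_of_walk k (fun k => (hW k).1).
have pL k := past_of_walk k loop_vertex_edge.
have zL k : never_resets (fun j : nat => loop_vertex (k - j%:Z)%R).
  by move=> j /=; rewrite addn_eq0 eqn0Ngt n_gt0.
have rW k : resets_unboundedly (fun j : nat => W (k - j%:Z)%R).
  have [|[]//|[_ /(_ 0)[j _ h]]] := past_dichotomy (pL k) (pW k).
    by rewrite subr0 => e; apply: (hW k).2.
  by case/eqP: (zL k j).
have uniq s t x k : @past _ G s x -> @past _ G t x -> never_resets s ->
    resets_unboundedly t -> s 0 = n + phase k :> nat -> t 0 = W k.
  move=> hs ht zs rt sk.
  have := past_off_diagonal hs ht (pL k) (pW k) zs (zL k) rt (rW k).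
  by rewrite subr0; apply; apply: val_inj.
(* Compactness gives no periodicity of [W]; it follows from the uniqueness of the walk that
   accompanies the loop. *)
have W_phase k k' : phase k = phase k' -> W k = W k'.
  move=> kk'; have := uniq _ _ _ k' (pL k) (pW k) (zL k) (rW k).
  by rewrite /= subr0 kk'; apply.
have loopE (i : 'I_p) : loop_vertex (i : nat) = rshift n i.
  by apply: val_inj; rewrite /= phase_small.
exists (fun i => W (i : nat)); split.
- move=> i; have [+ _] := hW (i : nat); rewrite phase_small //.
  congr edge; apply: W_phase; rewrite phase_succ phase_small //.
  by rewrite phase_small // ltn_pmod.
- by move=> i; rewrite -loopE; have [] := hW (i : nat).
move=> s t x hs ht st.
have off u v : @past _ G u x -> @past _ G v x -> never_resets u ->
    resets_unboundedly v -> exists i : 'I_p, u 0 = rshift n i /\ v 0 = W (i : nat).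
  move=> hu hv zu rv.
  have nu : n <= u 0 by apply: (past_in_loop hu) => j _; apply: zu.
  have ip : u 0 - n < p by have := ltn_ord (u 0); lia.
  exists (Ordinal ip); split; first by apply: val_inj; rewrite /= subnKC.
  by apply: uniq hu hv zu rv _; rewrite phase_small // subnKC.
have [[zs rt]|[zt rs]] := past_dichotomy hs ht st.
  by have [i h] := off s t hs ht zs rt; exists i; left.
by have [i [h h']] := off t s ht hs zt rs; exists i; right.
Qed.

(** * The fiber product *)

Notation K := (explicit_cover g n p).
Notation FP := (fiber_product beta_graph).

Lemma edge_reset_state (u v : V) a : a < g u -> v = 0 :> nat -> edge u a v.
Proof. by move=> au v0; split; [exact: ltnW|rewrite v0 /step au]. Qed.

Lemma edge_next_state (u v : V) : v = next_state u :> nat -> edge u (g u) v.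
Proof. by move=> vu; split; [exact: leqnn|rewrite vu /step ltnn]. Qed.

Lemma explicit_cover_edge (u : vertex K) a :
  a <= (match u with inl i => g i | inr (_, i) => g (n + i) end) ->
  exists v, edge u a v.
Proof.
have n0 : n < n + p by rewrite -[X in X < _]addn0 ltn_add2l.
case: u => [i|[b i]]; rewrite leq_eqVlt => /orP[/eqP ->|lt].
- have [e|e] := eqVneq i.+1 (n + p).
    by exists (inl (Ordinal n0)); apply: edge_loop.
  have lt : i.+1 < n + p by have := ltn_ord i; lia.
  by exists (inl (Ordinal lt)); apply: edge_next.
- by exists (inl origin); apply: edge_reset.
- have [e|e] := eqVneq i.+1 p.
    by exists (inr (b, Ordinal p_gt0)); apply: edge_loop'.
  have lt : i.+1 < p by have := ltn_ord i; lia.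
  by exists (inr (b, Ordinal lt)); apply: edge_next'.
by exists (inl origin); apply: edge_reset'.
Qed.

Lemma essential_explicit_cover : essential K.
Proof.
move=> u; split.
  case: u => [i|[b i]]; first by exists (g i); apply: explicit_cover_edge.
  by exists (g (n + i)); apply: explicit_cover_edge.
case: u => [[[|i] hi]|[b [[|i] hi]]].
- by exists 0, (inl origin); apply: edge_reset.
- by exists (g i), (inl (Ordinal (ltnW hi))); apply: edge_next.
- have lt : p.-1 < p by rewrite ltn_predL.
  exists (g (n + p.-1)), (inr (b, Ordinal lt)).
  by apply: (@edge_loop' _ _ _ _ (Ordinal lt)); rewrite //= prednK.
exists (g (n + i)), (inr (b, Ordinal (ltnW hi))).
exact: (@edge_next' _ _ _ _ (Ordinal (ltnW hi))).
Qed.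

Lemma edge_loop_state (i : 'I_p) :
  edge (rshift n i : V) (g (n + i)) (rshift n (ordS i) : V).
Proof.
apply: edge_next_state; rewrite /= /next_state -addnS eqn_add2l.
case: eqP => [->|ne]; first by rewrite modnn addn0.
by rewrite modn_small //; have := ltn_ord i; lia.
Qed.

(** The v_i go to the diagonal, the v' to a loop state with its companion, the v'' to the same pairs
    in the other order; [companion] shows that no other pair ends a past. *)
Lemma explicit_cover_embedding : exists psi : vertex K -> vertex FP,
  [/\ injective psi, forall u a v, edge u a v <-> edge (psi u) a (psi v) &
      forall s x, @past _ FP s x -> exists c, psi c = s 0].
Proof.
have [w [we wn wp]] := companion.
(* Hence the labels common to a loop state and its companion are exactly those up to [g (n + i)],
   and the smaller ones reset both. *)
have wle (i : 'I_p) : g (n + i) <= g (w i) by apply: edge_le (we i).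
pose psi (c : vertex K) : vertex FP :=
  match c with
  | inl i => (i, i)
  | inr (false, i) => (rshift n i, w i)
  | inr (true, i) => (w i, rshift n i)
  end.
have psi_edge u a v : edge u a v -> edge (psi u) a (psi v).
  case=> [i j k ki j0|i j ij|i j i_last jn|b i j k ki j0|b i j ij|b i j ip j0] /=.
  - by split; apply: edge_reset_state.
  - have e : edge (i : V) (g i) j.
      by apply: edge_next_state; rewrite /next_state -ij ltn_eqF.
    by split.
  - have e : edge (i : V) (g i) j.
      by apply: edge_next_state; rewrite /next_state i_last eqxx.
    by split.
  - have e1 : edge (rshift n i : V) k j by apply: edge_reset_state.
    have e2 : edge (w i) k j by apply: edge_reset_state => //; apply: leq_trans (wle i).
    by case: b; split.
  - have -> : j = ordS i by apply: val_inj; rewrite /= modn_small -?ij.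
    by case: b; split; first [exact: we|exact: edge_loop_state].
  have -> : j = ordS i by apply: val_inj; rewrite /= ip modnn.
  by case: b; split; first [exact: we|exact: edge_loop_state].
have psi_out u a P : edge (psi u) a P -> exists v, edge u a v.
  move=> [e1 e2]; apply: explicit_cover_edge.
  by case: u e1 e2 => [i|[[] i]] /= e1 e2;
    [case: e1|case: e2|case: e1].
(* If a v' and a v'' had the same image, two loop states would be companions of each other. Then
   [wle] equates their symbols and the situation persists one step on, so their tails agree and
   [tail_inj] identifies them, against [wn]. *)
have swap m (i j : 'I_p) : w i = rshift n j -> w j = rshift n i ->
    g (n + i + m) = g (n + j + m).
  elim: m i j => [|m IH] i j wi wj; have gij : g (n + i) = g (n + j).
  - by apply/eqP; rewrite eqn_leq; have := wle i; have := wle j; rewrite wi wj => -> ->.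
  - by rewrite !addn0.
  - by apply/eqP; rewrite eqn_leq; have := wle i; have := wle j; rewrite wi wj => -> ->.
  have tail (k : 'I_p) : g (n + k + m.+1) = g (n + ordS k + m).
    rewrite -addSnnS -same_tail_next; congr (g (_ + m)).
    by have [_] := edge_loop_state k; rewrite /= /step ltnn.
  rewrite !tail; apply: IH.
    have := we i; rewrite wi gij => h.
    exact: right_resolving_beta_graph h (edge_loop_state j).
  have := we j; rewrite wj -gij => h.
  exact: right_resolving_beta_graph h (edge_loop_state i).
have no_swap (i j : 'I_p) : w i = rshift n j -> w j <> rshift n i.
  move=> wi wj; apply: (wn i); rewrite wi; apply/val_inj/tail_inj.
  - exact: ltn_ord (rshift n j).
  - exact: ltn_ord (rshift n i).
  by move=> m; rewrite /= (swap m i j).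
have psi_inj : injective psi.
  move=> [i|[[] i]] [j|[[] j]] //= [e1 e2].
  - by rewrite e1.
  - by case: (wn j); rewrite -e1.
  - by case: (wn j); rewrite -e2.
  - by case: (wn i); rewrite e1.
  - by rewrite (ord_inj (addnI e2)).
  - by case: (no_swap i j).
  - by case: (wn i); rewrite e2.
  - by case: (no_swap i j).
  - by rewrite (ord_inj (addnI e1)).
exists psi; split=> //.
  move=> u a v; split; first exact: psi_edge.
  (* The label lifts to some edge from [u]; by determinism the image of that edge ends at
     [psi v]. *)
  move=> e; have [v' uv'] := psi_out _ _ _ e; suff -> : v = v' by [].
  have [e1 e2] := e; have [e1' e2'] := psi_edge _ _ _ uv'.
  apply: psi_inj; rewrite [LHS]surjective_pairing [RHS]surjective_pairing.
  by rewrite (right_resolving_beta_graph e1 e1') (right_resolving_beta_graph e2 e2').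
move=> s x ps.
have p1 : @past _ G (fun k => (s k).1) x by move=> k; case: (ps k).
have p2 : @past _ G (fun k => (s k).2) x by move=> k; case: (ps k).
case s0: (s 0) => [u v]; have [uv|/eqP uv] := eqVneq u v.
  by exists (inl u); rewrite /= -uv.
have [|i] := wp _ _ _ p1 p2; first by rewrite s0.
by rewrite s0 /= => -[[-> ->]|[-> ->]]; [exists (inr (false, i))|exists (inr (true, i))].
Qed.

End BetaGraph.

(** * Beta-expansions *)

Section BetaExpansions.
Variables (R : realType) (beta : R).
Hypothesis beta_gt1 : 1 < beta.

Notation rem := (beta_rem beta).
Notation digit := (beta_expansion beta).
Notation e1 := (beta_expansion beta 1).
Notation r := (beta_rem beta 1).

Lemma beta_gt0 : 0 < beta. Proof. exact: lt_trans ltr01 beta_gt1. Qed.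

Lemma rem_ge0 t k : 0 <= t -> 0 <= rem t k.
Proof.
move=> t0; elim: k => //= k IH.
by rewrite subr_ge0 Num.Theory.truncn_le mulr_ge0 // ltW // beta_gt0.
Qed.

Lemma digit_le t k : 0 <= t -> (digit t k)%:R <= beta * rem t k.
Proof.
by move=> t0; rewrite Num.Theory.truncn_le mulr_ge0 ?rem_ge0 // ltW // beta_gt0.
Qed.

Lemma remS t k : rem t k.+1 = beta * rem t k - (digit t k)%:R.
Proof. by []. Qed.

Lemma rem_lt1 t k : rem t k.+1 < 1.
Proof. by rewrite remS ltrBlDr nat1r Num.Theory.truncnS_gt. Qed.

Lemma r_le1 k : r k <= 1.
Proof. by case: k => // k; apply/ltW/rem_lt1. Qed.

Lemma rem_shift t k : rem (rem t 1) k = rem t k.+1.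
Proof. by elim: k => // k IH; rewrite remS [RHS]remS -IH /beta_expansion IH. Qed.

Lemma digit_shift t k : digit (rem t 1) k = digit t k.+1.
Proof. by rewrite /beta_expansion rem_shift. Qed.

(** If the first digit of [t] equals that of [r i], the remainders keep their order; if it is
    smaller, the new remainder is still below 1, which is [r 0]. *)
Lemma expansion_readable t i m : 0 <= t -> t < r i ->
  readable e1 i (mkseq (digit t) m).
Proof.
elim: m t i => [//|m IH] t i t0 ti; rewrite mkseq_succ /=.
have le : (digit t 0 <= e1 i)%N.
  by apply: Num.Theory.le_truncn; rewrite ler_pM2l ?beta_gt0 // ltW.
rewrite le /= -(eq_mkseq (digit_shift t)).
apply: IH; first exact: rem_ge0.
case: ltnP => [_|ge]; first exact: rem_lt1.
have -> : rem t 1 = beta * t - (digit t 0)%:R by [].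
rewrite remS (_ : digit t 0 = e1 i); last by apply/eqP; rewrite eqn_leq le.
by rewrite ltrD2r ltr_pM2l ?beta_gt0.
Qed.

Hypothesis e1_infinite : ~ finite_expansion e1.

Lemma e1_nz i : exists k, (0 < e1 (i + k))%N.
Proof.
apply: contrapT => /forallNP h; apply: e1_infinite; exists i => j ij.
by have := h (j - i)%N; rewrite subnKC //; case: (e1 j).
Qed.

Lemma r_gt0 i : 0 < r i.
Proof.
rewrite lt_neqAle rem_ge0 ?ler01 // andbT; apply/eqP => ri.
have r0 k : r (i + k) = 0.
  elim: k => [|k IH]; first by rewrite addn0.
  by rewrite addnS remS /beta_expansion IH mulr0 Num.Theory.truncn0 subr0.
by have [k] := e1_nz i; rewrite /beta_expansion r0 mulr0 Num.Theory.truncn0.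
Qed.

(** The point is built from the last digit backwards; [r_gt0] allows 0 for the empty word. *)
Lemma readable_expansion i w : readable e1 i w ->
  exists t, [/\ 0 <= t, t < r i & w = mkseq (digit t) (size w)].
Proof.
elim: w i => [|a w IH] i /=; first by exists 0; rewrite r_gt0.
move=> /andP[ai /IH[t [t0 tr ->]]]; rewrite size_mkseq.
(* This is the inverse branch of the beta-transformation for the digit [a]. *)
set s := (a%:R + t) / beta; have b0 := beta_gt0.
have bs : beta * s = a%:R + t by rewrite mulrC divfK // gt_eqF.
have t1 : t < 1 by apply: lt_le_trans tr (r_le1 _).
have da : digit s 0 = a.
  by apply: Num.Theory.truncn_def; rewrite bs lerDl t0 -natr1 ltrD2l.
have rs : rem s 1 = t by rewrite remS da bs addrC addKr.
exists s; split.
- by rewrite divr_ge0 ?addr_ge0 // ltW.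
- rewrite ltr_pdivrMr // mulrC; move: tr; case: ltnP => [lt _|ge].
    apply: (@lt_le_trans _ _ a.+1%:R); first by rewrite -natr1 ltrD2l.
    by apply: le_trans (digit_le i ler01); rewrite ler_nat.
  rewrite remS ltrBrDl; suff -> : e1 i = a by [].
  by apply/eqP; rewrite eqn_leq ge.
by rewrite mkseq_succ da -(eq_mkseq (digit_shift s)) rs.
Qed.

(** A factor starting at position [j] is a prefix of the expansion of [rem t j], which again lies in
    [0, 1[. *)
Lemma beta_language_readable w : beta_language beta w <-> readable e1 0 w.
Proof.
split=> [[t [t0 t1 [j ->]]]|/readable_expansion[t [t0 t1 ->]]].
  have digit_drop i : digit t (j + i) = digit (rem t j) i.
    rewrite /beta_expansion; congr (Num.truncn (_ * _)).
    by elim: i => [|i IH]; rewrite ?addn0 // addnS !remS /beta_expansion IH.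
  rewrite (eq_mkseq digit_drop); apply: expansion_readable; first exact: rem_ge0.
  by case: j {digit_drop} => // j; apply: rem_lt1.
by exists t; split=> //; exists 0%N; rewrite size_mkseq.
Qed.

Lemma readable_e1_origin i w : readable e1 i w -> readable e1 0 w.
Proof.
move=> /readable_expansion[t [t0 ti ->]]; apply: expansion_readable => //.
exact: lt_le_trans ti (r_le1 i).
Qed.

Lemma e1_gt0 : (0 < e1 0)%N.
Proof. by rewrite Num.Theory.truncn_gt0 mulr1 ltW. Qed.

End BetaExpansions.

(** A finite expansion would make the generating sequence repeat with period [k.+1]. *)
Lemma generating_sequence_infinite (R : realType) (beta : R) :
  ~ periodic (generating_sequence beta) ->
  ~ finite_expansion (beta_expansion beta 1) /\
  generating_sequence beta = beta_expansion beta 1.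
Proof.
rewrite /generating_sequence; case: asboolP => // fin; case.
set k := xget _ _; exists k.+1 => // i; by rewrite modnDr.
Qed.

Theorem proposition4p16 (R : realType) (beta : R) (hbeta : 1 < beta)
    (hev : eventually_periodic (generating_sequence beta))
    (hnper : ~ periodic (generating_sequence beta))
    (n p : nat)
    (hmin : minimal_preperiod_period (generating_sequence beta) n p)
    (F : lgraph nat) (hF : right_fischer_cover F (beta_shift beta))
    (C : subgraph (fiber_product F)) (hC : fiber_product_cover C) :
  lgraph_iso (lgraph_of_subgraph C)
    (explicit_cover (generating_sequence beta) n p).
Proof.
have [inf gE] := generating_sequence_infinite hnper.
move: hnper hmin; rewrite gE; set g := beta_expansion beta 1.
move=> aper [[p_gt0 per] minimal].
have n_gt0 : (0 < n)%N.
  rewrite lt0n; apply/eqP => n0; apply: aper; exists p => // i.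
  by apply: per; rewrite n0.
have tail_inj i j : (i < n + p)%N -> (j < n + p)%N -> same_tail g i j -> i = j.
  wlog: i j / (i <= j)%N => [wl ip jp ij|].
    by have [/wl|/ltnW/wl h] := leqP i j; [apply|apply/esym/h].
  rewrite leq_eqVlt => /orP[/eqP //|lt] ip jp ij.
  (* Equal tails at [i < j] make [i] and [j - i] a preperiod and a period, so minimality gives
     [n + p <= j]. *)
  have [|nl pl] := minimal i (j - i)%N; last by lia.
  split=> [|k ik]; first by rewrite subn_gt0.
  by have := ij (k - i)%N; rewrite subnKC // => ->; congr g; lia.
have g_aper m : (0 < m)%N -> ~ forall i, g (i + m)%N = g i.
  by move=> m0 h; apply: aper; exists m.
have g0_gt0 : (0 < g 0)%N := e1_gt0 hbeta.
have g_nz := e1_nz inf.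
have origin_ok := readable_e1_origin hbeta inf.
have language := beta_language_readable hbeta inf.
have pG : presents (beta_graph g n p) (beta_shift beta).
  exact: presents_beta_graph.
have [f f_bij f_edge] : exists2 f : vertex (beta_graph g n p) -> vertex F,
    bijective f & forall u a v, edge u a v <-> edge (f u) a (f v).
  apply: (right_fischer_cover_iso _ pG (origin_loop p n_gt0 g0_gt0) _ _ _ _ hF).
  - exact: right_resolving_beta_graph.
  - exact: walk_to_origin.
  - exact: walk_from_origin.
  - move=> x m Xx.
    apply/(readable_walk (i := 0%N) n_gt0 p_gt0 per g0_gt0) => //.
    apply/language; rewrite (eq_mkseq (g := fun i => x (0 + i%:Z))) => [|i].
      exact: Xx.
    by rewrite add0r.
  exact: follower_separated_beta_graph.
have [psi [psi_inj psi_edge psi_past]] :=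
  explicit_cover_embedding n_gt0 p_gt0 per tail_inj g_aper g0_gt0 origin_ok.
have [phi [phi_inj phi_edge phi_past]] :=
  fiber_product_embedding f_bij f_edge psi_inj psi_edge psi_past.
apply: maximal_essential_subgraph_iso phi_inj phi_edge _ phi_past hC.
exact: essential_explicit_cover.
Qed.
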